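(* Let $m,k\ge1$, $q=2^{km}$, $d=2^m$, $n=(q+1)(d-1)$, $N=(q-1)/(d-1)$, $r=q^2$, $\alpha$ a generator of $\mathrm{GF}(r)^*$, $\beta=\alpha^N$, $\mathrm{Tr}$ the trace from $\mathrm{GF}(r)$ to $\mathrm{GF}(q)$, and $\mathbf{c}_a=(\mathrm{Tr}(a\beta^0),\dots,\mathrm{Tr}(a\beta^{n-1}))$. Let $\widetilde{\mathcal{C}}=\{\mathbf{c}_a+b\mathbf{1}:a\in\mathrm{GF}(r),b\in\mathrm{GF}(q)\}$, where $\mathbf{1}$ is the all-one vector of $\mathrm{GF}(q)^n$. Then $\widetilde{\mathcal{C}}$ is a cyclic code of length $n$ and dimension $3$ over $\mathrm{GF}(q)$ whose only nonzero weights are $n-d$, $n-d+1$ and $n$. The minimum distance of its dual is $4$ if $m=1$ and $3$ if $m>1$. *)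

(* Defs.v *)
From HB Require Import structures.
From mathcomp Require Import all_boot all_order all_fingroup all_algebra all_field.
Set Implicit Arguments.
Unset Strict Implicit.
Unset Printing Implicit Defensive.
Import GRing.Theory.
Local Open Scope ring_scope.

Section Codes.

Variables (F : finFieldType) (n : nat).
Implicit Types (u v c : 'rV[F]_n) (C : {set 'rV[F]_n}).

Definition wt v : nat := #|[set i | v 0 i != 0]|.

Definition hdist u v : nat := #|[set i | u 0 i != v 0 i]|.

(* Distances are at most n, so the default value n + 1 is attained only by    *)
(* codes with at most one word: the zero code has parameters [n, 0, n + 1].   *)
Definition min_dist C : nat :=
  \big[minn/n.+1]_(p in setX C C | p.1 != p.2) hdist p.1 p.2.

(* (c_0, ..., c_(n-1)) |-> (c_(n-1), c_0, ..., c_(n-2)) *)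
Definition cshift c : 'rV[F]_n := \row_i c 0 (ord_pred i).

Definition cyclic_code C : Prop :=
  submod_closed C /\ {in C, forall c, cshift c \in C}.

(* For a linear code the span below is the code itself. *)
Definition code_dim C : nat := \dim <<enum C>>%VS.

Definition dual_code C : {set 'rV[F]_n} :=
  [set v : 'rV[F]_n | [forall c in C, \sum_i v 0 i * c 0 i == 0]].

End Codes.

Definition mult_generator (L : fieldType) (alpha : L) : Prop :=
  alpha != 0 /\ (forall x : L, x != 0 -> exists i : nat, x = alpha ^+ i).

Section Trace.

(* Every finite extension of a finite field F is a splitting field over F, so *)
(* asking for a splittingFieldType is no restriction.                         *)
Variables (F : finFieldType) (L : splittingFieldType F).

(* galTrace takes values in the line 1%VS of L; the coordinate along 1        *)
(* identifies this line with F, see trE.                                      *)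
Definition tr (x : L) : F :=
  coord [tuple (1 : L)] ord0 (galTrace 1%AS {:L}%AS x).

Lemma trE x : (tr x)%:A = galTrace 1%AS {:L}%AS x.
Proof.
have galL : galois 1%AS {:L}%AS by apply: finField_galois; exact: sub1v.
have := mem_galTrace galL (memvf x); set y := galTrace _ _ _ => y1.
have /coord_span : y \in <<[tuple (1%R : L)]>>%VS by rewrite span_seq1.
by rewrite big_ord_recl big_ord0 addr0.
Qed.

Definition trace_word n (beta a : L) : 'rV[F]_n := \row_i tr (a * beta ^+ i).

Definition aug_code n (beta : L) : {set 'rV[F]_n} :=
  [set trace_word n beta a + const_mx b | a : finvect_type L, b : F].

End Trace.

(* Main.v *)
Require Import Defs.
From HB Require Import structures.
From mathcomp Require Import all_boot all_order all_fingroup all_algebra all_field.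
From mathcomp Require Import ring zify.
Set Implicit Arguments.
Unset Strict Implicit.
Unset Printing Implicit Defensive.
Import GRing.Theory.
Local Open Scope ring_scope.

(* The powers of beta are the x in L = GF(q^2) whose norm x^(q+1) lies in
   GF(d)^*: together with 0 they form a Denniston maximal arc of degree d in the
   affine plane L over F = GF(q).  The zeros of the word (a, b) are the points
   of this arc on the line tr (a x) = b.  A line through 0 carries d - 1 powers
   of beta.  On any other line the norm restricts, up to a constant, to an
   irreducible polynomial t^2 + b t + c; since t^2 + b t is additive with kernel
   {0, b}, such a line carries 0 or d points.  A word of the dual is an affine
   dependency between powers of beta: no two of them coincide, some three
   are collinear exactly when d > 2, and any four are dependent. *)

(** * Additive quadratic polynomials in characteristic 2 *)

Section ArtinSchreier.

Variables (F : finFieldType) (b : F).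
Hypotheses (pchF : 2%N \in [pchar F]) (b_neq0 : b != 0).

Definition artin_schreier (t : F) : F := t ^+ 2 + b * t.
Local Notation p := artin_schreier.

Lemma artin_schreierD s t : p (s + t) = p s + p t.
Proof.
have e2 : (2 : F) = 0 by rewrite (pcharf0 pchF).
have -> : p (s + t) = p s + p t + 2 * (s * t) by rewrite /p; ring.
by rewrite e2 mul0r addr0.
Qed.

Lemma artin_schreier_fibre t : [set s | p s == p t] = [set t; t + b].
Proof.
apply/setP=> s; rewrite !inE.
have -> : (p s == p t) = (p s + p t == 0).
  by rewrite addr_eq0 (oppr_pchar2 pchF).
rewrite -artin_schreierD /p expr2 -mulrDl mulf_eq0 orbC.
rewrite !addr_eq0 !(oppr_pchar2 pchF); congr (_ || _).
by rewrite -[in LHS](oppr_pchar2 pchF t) subr_eq addrC.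
Qed.

Lemma card_artin_schreier_fibre t : #|[set s | p s == p t]| = 2%N.
Proof.
by rewrite artin_schreier_fibre cards2 -subr_eq0 opprD addNKr oppr_eq0 b_neq0.
Qed.

(** Every value of [p] is taken at exactly two points, [t] and [t + b], so the preimage is counted
    value by value. *)
Lemma card_artin_schreier_preim (A : {set F}) :
  #|p @^-1: A| = (2 * #|A :&: [set p t | t : F]|)%N.
Proof.
rewrite -sum1_card (partition_big p (mem (A :&: [set p t | t : F]))) /=;
  last first.
  by move=> t; rewrite !inE => ->; rewrite imset_f.
rewrite mulnC -sum_nat_const; apply: eq_bigr => e.
rewrite inE => /andP[Ae /imsetP[t _ def_e]].
rewrite -(card_artin_schreier_fibre t) -sum1_card; apply: eq_bigl => s.
by rewrite !inE -def_e; case: eqP => [->|]; rewrite ?Ae ?andbF.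
Qed.

Variable c : F.
Hypothesis irr_c : forall t, p t + c != 0.

(** The image of [p] is an additive subgroup of index 2, since [p] is two-to-one. By [irr_c] it
    misses [c], so adding [c] exchanges the image and its complement. *)
Lemma artin_schreier_split e :
  (e \in [set p t | t : F]) = (e + c \notin [set p t | t : F]).
Proof.
set H := [set p t | t : F].
have Hc x : x \in H -> x + c \notin H.
  case/imsetP=> t _ ->; apply/imsetP=> -[s _ /eqP].
  rewrite -subr_eq0 (oppr_pchar2 pchF) addrAC -artin_schreierD.
  by apply/negP/irr_c.
pose Hc' := [set x + c | x in H].
have disj : [disjoint H & Hc'].
  rewrite disjoint_sym disjoints_subset.
  by apply/subsetP=> _ /imsetP[x Hx ->]; rewrite inE Hc.
have cH : (#|F| = 2 * #|H|)%N.
  by have := card_artin_schreier_preim setT; rewrite preimsetT setTI cardsT.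
(* [H] and its translate by [c] are disjoint and each has half the size of the field, so they cover
   it. *)
have /eqP full : H :|: Hc' == setT.
  rewrite eqEcard subsetT /= cardsU (disjoint_setI0 disj) cards0 subn0.
  have -> : #|Hc'| = #|H| by apply/card_imset/addIr.
  by rewrite cardsT cH; lia.
apply/idP/idP => [/Hc //|]; have : e \in H :|: Hc' by rewrite full inE.
rewrite inE => /orP[//|/imsetP[x Hx ->]].
by rewrite -addrA (addrr_pchar2 pchF) addr0 Hx.
Qed.

Variable E : {set F}.
Hypothesis E_sub : {in E &, forall x y, x + y \in E}.

(* The translate of [p^-1 E] below is either empty or a coset of [p^-1 E],
   and the two sets have [2 #|E|] elements together. *)
Lemma card_artin_schreier_translate :
  #|[set t | p t + c \in E]| \in [:: 0%N; #|E|].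
Proof.
set S := [set t | _]; have [->|[t St]] := set_0Vmem S; first by rewrite cards0.
have eSV : #|S| = #|p @^-1: E|.
  rewrite -[RHS](card_imset _ (addrI t)).
  apply: eq_card => s; apply/idP/imsetP=> [|[u Su ->]].
    rewrite inE => Es; exists (t + s); last first.
      by rewrite addrA (addrr_pchar2 pchF) add0r.
    move: St; rewrite !inE artin_schreierD => /E_sub/(_ Es).
    by rewrite addrACA (addrr_pchar2 pchF) addr0.
  move: St Su; rewrite !inE => Et Eu.
  by rewrite artin_schreierD addrAC E_sub.
have := card_artin_schreier_preim E.
have eS : S = p @^-1: [set e | e + c \in E] by apply/setP=> u; rewrite !inE.
have := card_artin_schreier_preim [set e | e + c \in E]; rewrite -eS.
set H := [set p t | t : F].
(* Translation by [c] swaps [H] with its complement. Hence [#|S|] is both twice the part of [E]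
   outside [H] and, by [eSV], twice the part inside; adding the two gives [#|S| = #|E|]. *)
have -> : #|[set e | e + c \in E] :&: H| = #|E :\: H|.
  rewrite -[RHS](card_imset _ (addIr c)).
  have xcc x : x + c + c = x by rewrite -addrA (addrr_pchar2 pchF) addr0.
  apply: eq_card => x; rewrite !inE; apply/andP/imsetP => [[Ex Hx]|[y]].
    by exists (x + c); rewrite ?xcc // inE -artin_schreier_split Hx.
  by rewrite inE => /andP[Hy Ey] ->; rewrite artin_schreier_split xcc Ey.
by have := cardsID H E; rewrite !inE; lia.
Qed.

End ArtinSchreier.

(** * Weight, dimension, minimum distance and dual of a linear code *)

Section LinearCodes.

Variables (F : finFieldType) (n : nat).
Implicit Types (v c : 'rV[F]_n) (C : {set 'rV[F]_n}).

Lemma wt_zeros v : (wt v + #|[set i | (v 0 i == 0)%R]|)%N = n.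
Proof.
rewrite /wt -[RHS]card_ord -(cardsC [set i | v 0 i != 0]); congr (_ + _)%N.
by apply: eq_card => i; rewrite !inE negbK.
Qed.

Lemma wt_eq0 v : (wt v == 0%N) = (v == 0).
Proof.
rewrite cards_eq0; apply/eqP/eqP => [v0|->]; last first.
  by apply/setP=> i; rewrite !inE mxE eqxx.
apply/rowP=> i; rewrite mxE; apply/eqP.
by move/setP/(_ i): v0; rewrite !inE => /negbFE.
Qed.

Lemma hdist_wt u v : hdist u v = wt (u - v).
Proof. by apply: eq_card => i; rewrite !inE !mxE subr_eq0. Qed.

Lemma code_dim_card C k :
  submod_closed C -> #|C| = (#|F| ^ k)%N -> code_dim C = k.
Proof.
case=> C0 CZD cardC.
have CD : {in C &, forall u v, u + v \in C}.
  by move=> u v Cu Cv; rewrite -[u]scale1r CZD.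
have spanC : <<enum C>>%VS =i C.
  move=> v; apply/idP/idP=> [/(@coord_span _ _ _ (in_tuple (enum C)))->|Cv].
    apply: (big_ind (fun x => x \in C)) => // i _.
    rewrite -[_ *: _]addr0 CZD //.
    by rewrite -mem_enum mem_nth.
  by apply: memv_span; rewrite mem_enum.
apply/eqP; rewrite -(eqn_exp2l _ _ (finNzRing_gt1 F)) -cardC.
by rewrite -(eq_card spanC) card_vspace.
Qed.

Lemma min_dist_le C v : submod_closed C -> v \in C -> v != 0 ->
  (min_dist C <= wt v)%N.
Proof.
case=> C0 _ Cv nz_v; rewrite -[v]subr0 -hdist_wt /min_dist.
pose P (p : 'rV[F]_n * 'rV[F]_n) := (p \in setX C C) && (p.1 != p.2).
apply: (@Order.TotalTheory.bigmin_le_cond _ nat _ n.+1 (v, 0) P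
  (fun p => hdist p.1 p.2)).
by rewrite /P !inE /= Cv C0.
Qed.

Lemma min_dist_len C : (min_dist C <= n.+1)%N.
Proof. exact: (@Order.TotalTheory.bigmin_le_id _ nat). Qed.

(** Linearity reduces a pair of distinct words to their nonzero difference; the bound on [w] handles
    the default value [n.+1]. *)
Lemma min_dist_ge C w : submod_closed C -> (w <= n.+1)%N ->
  {in C, forall v, v != 0 -> (w <= wt v)%N} -> (w <= min_dist C)%N.
Proof.
case=> _ CZD w_n geC; apply: (big_ind (fun x => w <= x)%N) => //.
  by move=> x y wx wy; rewrite leq_min wx.
case=> u v /= /andP[]; rewrite inE /= => /andP[Cu Cv] uv.
rewrite hdist_wt; apply: geC; last by rewrite subr_eq0.
by rewrite addrC -scaleN1r CZD.
Qed.

Lemma dual_codeP C v :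
  reflect {in C, forall c, \sum_i v 0 i * c 0 i = 0} (v \in dual_code C).
Proof. by rewrite inE; apply: (iffP forall_inP) => H c /H/eqP. Qed.

Lemma dual_code_submod C : submod_closed (dual_code C).
Proof.
split=> [|a u v /dual_codeP Du /dual_codeP Dv]; apply/dual_codeP=> c Cc.
  by rewrite big1 // => i _; rewrite mxE mul0r.
rewrite (eq_bigr (fun i => a * (u 0 i * c 0 i) + v 0 i * c 0 i)).
  by rewrite big_split -mulr_sumr /= Du // Dv // mulr0 addr0.
by move=> i _; rewrite !mxE mulrDl mulrA.
Qed.

Lemma sum_support v (x : 'I_n -> F) :
  \sum_i v 0 i * x i = \sum_(i in [set i | v 0 i != 0]) v 0 i * x i.
Proof.
rewrite [LHS](bigID (fun i => v 0 i != 0)) /= addrC big1 => [|i /negPn/eqP->].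
  by rewrite add0r; apply: eq_bigl => i; rewrite inE.
by rewrite mul0r.
Qed.

End LinearCodes.

(** * Trace and norm of a quadratic extension in characteristic 2 *)

Lemma exprD_pchar2 (R : comNzRingType) (e : nat) (x y : R) :
  2%N \in [pchar R] -> (x + y) ^+ (2 ^ e) = x ^+ (2 ^ e) + y ^+ (2 ^ e).
Proof.
move=> pchR; rewrite exprDn_pchar // (eq_pnat _ (pcharf_eq pchR)).
by rewrite pnatX pnat_id.
Qed.

Section QuadraticTrace.

Variables (F : finFieldType) (L : splittingFieldType F) (e : nat).
Hypotheses (cardF : #|F| = (2 ^ e)%N) (dimL : \dim {:L} = 2%N).
Local Notation q := #|F|.

Let pchF : 2%N \in [pchar F]. Proof. exact: card_finPcharP cardF isT. Qed.
Let pchL : 2%N \in [pchar L]. Proof. by rewrite pchar_lalg. Qed.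

Let frobD (x y : L) : (x + y) ^+ q = x ^+ q + y ^+ q.
Proof. by rewrite cardF exprD_pchar2. Qed.

Let frobZ (s : F) (x : L) : (s *: x) ^+ q = s *: x ^+ q.
Proof. by rewrite exprZn expf_card. Qed.

Let frob_in1 (x : L) : x ^+ q = x -> exists t : F, x = t%:A.
Proof.
by move=> xq; apply/vlineP; rewrite Fermat's_little_theorem dimv1 expn1 xq.
Qed.

Let frobK (x : L) : x ^+ q ^+ q = x.
Proof.
have := Fermat's_little_theorem {:L} x; rewrite memvf dimL => /esym/eqP.
by rewrite -mulnn exprM.
Qed.

(** The Galois group has order 2 and is generated by the Frobenius map, so the trace has just these
    two terms. *)
Lemma tr_frobenius (x : L) : (tr x)%:A = x + x ^+ q.
Proof.
have [g gen_g gE] := finField_galois_generator (sub1v {:L}).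
move: gen_g; rewrite /cyclic.generator => /eqP gen_g.
have og : #[g]%g = 2%N.
  rewrite orderE -gen_g -galois_dim ?dimv1 ?divn1 //.
  by apply: finField_galois; apply: sub1v.
have g1 : (1%g : gal_of {:L}) \notin [set g].
  by rewrite inE eq_sym -order_eq1 og.
rewrite trE /galTrace gen_g cycle2g // big_setU1 //= big_set1 gal_id.
by rewrite gE ?memvf // dimv1 expn1.
Qed.

Lemma tr_linear s (x y : L) : tr (s *: x + y) = s * tr x + tr y.
Proof.
apply: (fmorph_inj (in_alg L)); rewrite /= scalerDl -scalerA !tr_frobenius.
by rewrite frobD frobZ scalerDr addrACA.
Qed.

Lemma trZ s (x : L) : tr (s *: x) = s * tr x.
Proof.
apply: (fmorph_inj (in_alg L)); rewrite /= -scalerA !tr_frobenius.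
by rewrite frobZ scalerDr.
Qed.

Lemma trD (x y : L) : tr (x + y) = tr x + tr y.
Proof. by have := tr_linear 1 x y; rewrite scale1r mul1r. Qed.

Lemma tr_in_alg s : tr (s%:A : L) = 0.
Proof.
apply: (fmorph_inj (in_alg L)); rewrite /= tr_frobenius scale0r.
by rewrite frobZ expr1n (addrr_pchar2 pchL).
Qed.

Lemma tr0 : tr (0 : L) = 0.
Proof. by rewrite -(scale0r 1) tr_in_alg. Qed.

Lemma tr_eq0 (x : L) : tr x = 0 -> exists t : F, x = t%:A.
Proof.
move=> tx; apply: frob_in1; apply/eqP; rewrite eq_sym.
by rewrite -subr_eq0 (oppr_pchar2 pchL) -tr_frobenius tx scale0r.
Qed.

(** As [L] has dimension 2, it has an element outside [F]. Its trace is nonzero by [tr_eq0] and can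
    be rescaled to 1. *)
Lemma tr_surj : exists y : L, tr y = 1.
Proof.
have [y ty] : exists y : L, tr y != 0.
  have /subvPn[y _ y1] : ~~ ({:L} <= 1)%VS.
    by apply/negP=> /dimvS; rewrite dimL dimv1.
  exists y; apply: contra y1 => /eqP/tr_eq0[t ->]; apply/vlineP.
  by exists t.
by exists ((tr y)^-1 *: y); rewrite trZ mulVf.
Qed.

Lemma tr_nondeg (x : L) : x != 0 -> exists a : L, tr (a * x) = 1.
Proof.
have [y ty] := tr_surj => nz_x; exists (y / x).
by rewrite divfK.
Qed.

Lemma norm_in_alg (x : L) : exists c : F, x ^+ q.+1 = c%:A.
Proof. by apply: frob_in1; rewrite exprSr exprMn frobK mulrC. Qed.

(** The norm is the product of [w + t] and its conjugate [w ^+ q + t]: the linear coefficient in [t]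
    is the trace of [w], the constant term its norm. *)
Lemma norm_shift (w : L) c t : w ^+ q.+1 = c%:A ->
  (w + t%:A) ^+ q.+1 = (artin_schreier (tr w) t + c)%:A.
Proof.
move=> wc; have -> : (artin_schreier (tr w) t + c)%:A =
    t%:A ^+ 2 + (w + w ^+ q) * t%:A + w * w ^+ q :> L.
  rewrite -exprS wc -tr_frobenius -[LHS]/(in_alg L _).
  by rewrite /artin_schreier !rmorphD rmorphXn rmorphM.
by rewrite exprS frobD frobZ expr1n; ring.
Qed.

(** * Intersection of the powers of [beta] with the lines of the plane [L] *)

Variables (m n : nat) (beta : L).
Local Notation d := (2 ^ m)%N.
Hypotheses (m_gt0 : (0 < m)%N) (n_eq : n = (q.+1 * d.-1)%N).
Hypothesis beta_prim : n.-primitive_root beta.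

Let d_gt1 : (1 < d)%N. Proof. by rewrite -[1%N]/(2 ^ 0)%N ltn_exp2l. Qed.
Let dK : d = d.-1.+1. Proof. by rewrite prednK // ltnW. Qed.

(** The norm of [beta] is a primitive root of unity of order [d - 1] lying in [F]; its powers and 0
    form the copy of GF(d) inside [F]. *)
Lemma card_subfield : #|[set z : F | z ^+ d == z]| = d.
Proof.
have d1n : (d.-1 %| n)%N by rewrite n_eq dvdn_mull.
have := dvdn_prim_root beta_prim d1n.
rewrite n_eq mulnK; last by rewrite -ltnS -dK.
have [g ->] := norm_in_alg beta; rewrite -[_%:A]/(in_alg L g).
rewrite fmorph_primitive_root => g_prim.
have -> : [set z : F | z ^+ d == z] =
    0 |: [set g ^+ (i : 'I_d.-1) | i : 'I_d.-1].
  apply/setP=> z; rewrite !inE [in LHS]dK exprS.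
  have [->|nz_z] := eqVneq z 0; first by rewrite mul0r eqxx.
  rewrite -{3}[z]mulr1 (inj_eq (mulfI nz_z)).
  apply/eqP/imsetP => [/(prim_rootP g_prim)[i ->]|].
    by exists i.
  by case=> i _ ->; rewrite exprAC (prim_expr_order g_prim) expr1n.
rewrite cardsU1 card_imset ?card_ord; last first.
  move=> i j /eqP; rewrite (eq_prim_root_expr g_prim) !modn_small //.
  by move/eqP/val_inj.
case: imsetP => [[i _ /esym/eqP]|_]; last by rewrite add1n -dK.
rewrite expf_eq0 => /andP[_ /eqP g0]; have := prim_expr_order g_prim.
by move/eqP; rewrite g0 expr0n eqn0Ngt -ltnS -dK d_gt1 eq_sym oner_eq0.
Qed.

(** For nonzero [a], these index the powers of [beta] on one affine line. In characteristic 2 they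
    are also the zero positions of the word given by [a] and [b]. *)
Definition trace_fibre (a : L) (b : F) :=
  [set i : 'I_n | tr (a * beta ^+ i) == b].

(* The points of the line [tr (a x) = b] are [x = (w + t) / a] with [t] in
   [F] and [tr w = b]; such a point is a power of [beta] iff its norm to [F],
   a quadratic polynomial in [t], lies in the multiplicative group of GF(d). *)
Lemma card_trace_fibre a b : a != 0 ->
  #|trace_fibre a b| \in if b == 0 then [:: d.-1] else [:: 0%N; d].
Proof.
move=> nz_a; have [y ty] := tr_surj.
pose w := b *: y; have tw : tr w = b by rewrite trZ ty mulr1.
have [c wc] := norm_in_alg w; have [nu anu] := norm_in_alg a.
have nz_nu : nu != 0.
  apply: contraNneq (expf_neq0 q.+1 nz_a) => nu0.
  by rewrite anu nu0 scale0r.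
(* [E] is [nu] times GF(d), because [(w + t) / a] has norm [p / nu], where [p] is the norm of
   [w + t]. The value 0 also lies in [E] and is removed in [S']. *)
pose E := [set e | (e / nu) ^+ d == e / nu].
have cardE : #|E| = d.
  rewrite -card_subfield -[RHS](card_imset _ (mulfI nz_nu)).
  apply: eq_card => x; rewrite inE; apply/idP/imsetP => [Ex|[z]].
    by exists (x / nu); rewrite ?inE // mulrC divfK.
  by rewrite inE => Ez ->; rewrite mulrC mulKf.
have E_sub : {in E &, forall x y, x + y \in E}.
  move=> x z; rewrite !inE => /eqP Ex /eqP Ez.
  by rewrite mulrDl exprD_pchar2 // Ex Ez.
pose S := [set t | artin_schreier b t + c \in E].
pose S' := [set t in S | artin_schreier b t + c != 0].
have cardS' : #|trace_fibre a b| = #|S'|.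
  (* On the fibre the difference lies in [F]; since [tr y = 1], multiplying it by [y] and taking the
     trace recovers the parameter [t]. *)
  pose f (i : 'I_n) := tr (y * (a * beta ^+ i - w)).
  have fE i : i \in trace_fibre a b -> a * beta ^+ i = w + (f i)%:A.
    rewrite inE => /eqP ti.
    have [t et] : exists t : F, a * beta ^+ i - w = t%:A.
      apply: tr_eq0; rewrite (oppr_pchar2 pchL) trD ti tw.
      exact: addrr_pchar2.
      by rewrite /f et mulr_algr trZ ty mulr1 -et addrC subrK.
  have f_inj : {in trace_fibre a b &, injective f}.
    move=> i j Si Sj eq_f; have := fE i Si; rewrite eq_f -(fE j Sj).
    move/(mulfI nz_a)/eqP; rewrite (eq_prim_root_expr beta_prim).
    by rewrite !modn_small // => /eqP/val_inj.
  rewrite -(card_in_imset f_inj); apply: eq_card => t.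
  have normt : (w + t%:A) ^+ q.+1 = (artin_schreier b t + c)%:A.
    by rewrite (norm_shift _ wc) tw.
  set p := artin_schreier b t + c in normt *.
  have zE : ((w + t%:A) / a) ^+ q.+1 = (p / nu)%:A.
    rewrite expr_div_n normt anu -[p%:A]/(in_alg L p) -[nu%:A]/(in_alg L nu).
    by rewrite -fmorph_div.
  have S'E : (t \in S') = ((p / nu) ^+ d.-1 == 1).
    rewrite !inE -/p [in LHS]dK exprS.
    have [->|nz_p] := eqVneq p 0.
      rewrite mul0r andbF expr0n eqn0Ngt -ltnS -dK d_gt1.
      by rewrite eq_sym oner_eq0.
    rewrite andbT -{3}[p / nu]mulr1 (inj_eq (mulfI _)) //.
    by rewrite mulf_neq0 ?invr_eq0.
  rewrite S'E; apply/imsetP/eqP => [[i /fE Si def_t]|zd].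
    apply: (fmorph_inj (in_alg L)); rewrite rmorphXn rmorph1 /= -zE def_t -Si.
    rewrite mulrC mulKf // -exprM exprAC -n_eq.
    by rewrite (prim_expr_order beta_prim) expr1n.
  have : ((w + t%:A) / a) ^+ n = 1.
    by rewrite n_eq exprM zE -[_%:A]/(in_alg L _) -rmorphXn zd rmorph1.
  case/(prim_rootP beta_prim)=> i def_i.
  have ai : a * beta ^+ i = w + t%:A by rewrite -def_i mulrC divfK.
  have Si : i \in trace_fibre a b by rewrite inE ai trD tw tr_in_alg addr0.
  exists i => //.
  by rewrite /f ai addrAC subrr add0r mulr_algr trZ ty mulr1.
rewrite cardS'; case: eqP => [b0|/eqP nz_b].
  (* For a line through 0 the polynomial is [t ^+ 2], and squaring is bijective on [F], so [S'] is
     equinumerous with [E :\ 0]. *)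
  have w0 : w = 0 by rewrite /w b0 scale0r.
  have c0 : c = 0.
    by apply: (fmorph_inj (in_alg L)); rewrite rmorph0 /= -wc w0 expr0n.
  have sq_inj : injective (fun t : F => t ^+ 2).
    move=> s t /eqP; rewrite -subr_eq0 subr_sqr mulf_eq0 subr_eq0.
    by rewrite addr_eq0 (oppr_pchar2 pchF) orbb => /eqP.
  have -> : S' = (fun t : F => t ^+ 2) @^-1: (E :\ 0).
    apply/setP=> t; rewrite /S' /S /artin_schreier b0 c0 !inE.
    by rewrite mul0r !addr0 andbC.
  have -> : #|(fun t : F => t ^+ 2) @^-1: (E :\ 0)| = #|E :\ 0|.
    rewrite on_card_preimset //; exists (finv (fun t : F => t ^+ 2)) => t _.
      exact: (finv_f sq_inj).
    exact: (f_finv sq_inj).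
  have E0 : 0 \in E by rewrite inE mul0r expr0n eqn0Ngt ltnW.
  by rewrite inE -cardE (cardsD1 0 E) E0.
(* A root would put [w] in [F], forcing its trace [b] to be 0. *)
have irr t : artin_schreier b t + c != 0.
  rewrite -(inj_eq (fmorph_inj (in_alg L))) rmorph0 /=.
  have := norm_shift t wc; rewrite tw => <-; apply: expf_neq0.
  apply: contra_neq nz_b => /eqP; rewrite addr_eq0 => /eqP w_in.
  by rewrite -tw w_in -scaleNr tr_in_alg.
have -> : S' = S by apply/setP=> t; rewrite inE irr andbT.
by have := card_artin_schreier_translate pchF nz_b irr E_sub; rewrite cardE.
Qed.

(** * Cyclicity, size and weights of the augmented trace code *)

Local Notation word a b := (trace_word n beta a + const_mx b).
Local Notation C := (aug_code n beta).

Let n_gt0 : (0 < n)%N. Proof. exact: prim_order_gt0 beta_prim. Qed.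

Lemma aug_codeP c : reflect (exists a b, c = word a b) (c \in C).
Proof.
apply: (iffP imset2P) => [[a b _ _ ->]|[a [b ->]]]; first by exists a, b.
by exists a b.
Qed.

Lemma aug_wordE a b i : (word a b) 0 i = tr (a * beta ^+ i) + b.
Proof. by rewrite !mxE. Qed.

Lemma aug_word_linear s a a' b b' :
  word (s *: a + a') (s * b + b') = s *: word a b + word a' b'.
Proof.
apply/rowP=> i; rewrite !mxE mulrDl -scalerAl tr_linear.
by rewrite mulrDr addrACA.
Qed.

Lemma aug_code_submod : submod_closed C.
Proof.
split=> [|s _ _ /aug_codeP[a [b ->]] /aug_codeP[a' [b' ->]]]; apply/aug_codeP.
  by exists 0, 0; apply/rowP=> i; rewrite !mxE mul0r tr0 addr0.
by exists (s *: a + a'), (s * b + b'); rewrite aug_word_linear.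
Qed.

Lemma aug_code_cyclic : cyclic_code C.
Proof.
have nz_beta : beta != 0.
  apply: contra_eq_neq (prim_expr_order beta_prim) => ->.
  by rewrite expr0n eqn0Ngt n_gt0 eq_sym oner_eq0.
split=> [|_ /aug_codeP[a [b ->]]]; first exact: aug_code_submod.
(* The shift lowers every exponent of [beta] by one, which division of [a] by [beta] achieves; the
   wrap-around at index 0 is absorbed by [beta ^+ n = 1]. *)
apply/aug_codeP; exists (a / beta), b; apply/rowP=> i; rewrite !mxE.
congr (tr _ + _); rewrite -mulrA; congr (_ * _).
rewrite (prim_expr_mod beta_prim) -subn1 -addnBA // exprD.
rewrite mulrC; congr (_ * _); apply: (mulfI nz_beta).
by rewrite -exprS subn1 prednK // (prim_expr_order beta_prim) mulfV.
Qed.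

Lemma wt_aug_word a b : (wt (word a b) + #|trace_fibre a b|)%N = n.
Proof.
rewrite -[RHS](wt_zeros (word a b)); congr (_ + _)%N; apply: eq_card => i.
by rewrite !inE aug_wordE addr_eq0 (oppr_pchar2 pchF).
Qed.

(** This makes the truncated difference [n - d] positive, so words with nonzero [a] cannot
    vanish. *)
Let n_large : (d < n)%N.
Proof.
have : (1 < q)%N := finNzRing_gt1 F.
by rewrite n_eq; nia.
Qed.

Lemma wt_aug_word_cst b : b != 0 -> wt (word 0 b) = n.
Proof.
move=> nz_b; rewrite -[RHS](wt_aug_word 0 b).
rewrite [X in (_ + X)%N]eq_card0 ?addn0 // => i.
by rewrite !inE mul0r tr0 eq_sym (negbTE nz_b).
Qed.

Lemma wt_aug_word_line a b : a != 0 ->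
  wt (word a b) \in if b == 0 then [:: (n - d + 1)%N] else [:: n; (n - d)%N].
Proof.
move=> nz_a; have := card_trace_fibre b nz_a; have := wt_aug_word a b.
by have := n_large; case: eqP => _; rewrite !inE; lia.
Qed.

Lemma aug_word_eq0 a b : word a b = 0 -> a = 0 /\ b = 0.
Proof.
move/eqP; rewrite -wt_eq0 => wt0.
have a0 : a = 0.
  apply/eqP; apply: contraTT wt0 => /(wt_aug_word_line b).
  by have := n_large; case: ifP => _; rewrite !inE; lia.
split=> //; apply/eqP; apply: contraTT wt0 => /wt_aug_word_cst.
rewrite a0 => ->.
by rewrite -lt0n.
Qed.

Lemma card_aug_code : #|finvect_type L| = (q ^ 2)%N -> #|C| = (q ^ 3)%N.
Proof.
pose f (p : finvect_type L * F) := word (p.1 : L) p.2.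
move=> cardL; have -> : C = f @: setT.
  apply/setP=> c; apply/aug_codeP/imsetP => [[a [b ->]]|[p _ ->]].
    by exists (a, b).
  by exists p.1, p.2.
rewrite card_in_imset; first by rewrite cardsT card_prod cardL mulnC -expnS.
move=> [a b] [a' b'] _ _; rewrite /f /= => eqw.
have : word ((-1) *: a + a') (-1 * b + b') = 0.
  by rewrite aug_word_linear scaleN1r eqw addNr.
case/aug_word_eq0; rewrite scaleN1r mulN1r ![- _ + _]addrC.
by move=> /subr0_eq-> /subr0_eq->.
Qed.

(** The line of trace 0 holds only [d - 1] of the [n] powers of [beta]. A power off it lies on a
    parallel line, which is then not empty and so carries [d] of them. *)
Lemma trace_fibre_nonempty : exists2 b, b != 0 & #|trace_fibre 1 b| = d.
Proof.
have [i nz] : exists i : 'I_n, tr (beta ^+ i) != 0.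
  apply/existsP; apply: contraTT n_large => /existsPn all0.
  have := card_trace_fibre 0 (oner_neq0 L); rewrite eqxx inE => /eqP.
  rewrite [LHS](_ : _ = n) => [|]; first by lia.
  rewrite -[RHS]card_ord; apply: eq_card => i.
  by rewrite !inE mul1r; have := all0 i; rewrite negbK.
exists (tr (beta ^+ i)) => //.
have := card_trace_fibre (tr (beta ^+ i)) (oner_neq0 L).
rewrite (negbTE nz) !inE => /orP[|/eqP //].
by rewrite cards_eq0 => /eqP/setP/(_ i); rewrite !inE mul1r eqxx.
Qed.

Lemma aug_code_weights w : (w != 0%N /\ exists2 c, c \in C & wt c = w) <->
  w \in [:: (n - d)%N; (n - d + 1)%N; n].
Proof.
split=> [[nz_w [_ /aug_codeP[a [b ->]] def_w]]|].
  have [a0|nz_a] := eqVneq a 0; last first.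
    have := wt_aug_word_line b nz_a; rewrite def_w !inE.
    by case: ifP => _; rewrite !inE; lia.
  have [b0|nz_b] := eqVneq b 0.
    case/negP: nz_w; rewrite -def_w a0 b0 wt_eq0; apply/eqP/rowP=> i.
    by rewrite aug_wordE mul0r tr0 addr0 mxE.
  by rewrite -def_w a0 wt_aug_word_cst // !inE eqxx !orbT.
have wordC a b : word a b \in C by apply/aug_codeP; exists a, b.
have nl := n_large; rewrite !inE => /or3P[] /eqP->; (split; first by lia).
- have [b nz_b fib] := trace_fibre_nonempty; exists (word 1 b) => //.
  apply: (@addIn d); rewrite subnK 1?ltnW // -[in LHS]fib.
  exact: wt_aug_word.
- exists (word 1 0) => //; have := wt_aug_word_line 0 (oner_neq0 L).
  by rewrite eqxx inE => /eqP.
by exists (word 0 1) => //; rewrite wt_aug_word_cst // oner_neq0.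
Qed.

(** * Words of small weight in the dual code *)

Lemma dual_word_pairing v a b : v \in dual_code C ->
  \sum_(i in [set i | v 0 i != 0]) v 0 i * (tr (a * beta ^+ i) + b) = 0.
Proof.
move/dual_codeP=> Dv; rewrite -[RHS](Dv (word a b)); last first.
  by apply/aug_codeP; exists a, b.
by rewrite [RHS]sum_support; apply: eq_bigr => i _; rewrite aug_wordE.
Qed.

Let beta_inj (i j : 'I_n) : i != j -> beta ^+ i - beta ^+ j != 0.
Proof. by rewrite subr_eq0 (eq_prim_root_expr beta_prim) !modn_small. Qed.

Lemma dual_wt_ge3 v : v \in dual_code C -> v != 0 -> (3 <= wt v)%N.
Proof.
move=> Dv; rewrite -wt_eq0 -lt0n => wt_gt0.
have dualE := dual_word_pairing _ _ Dv; rewrite /wt in wt_gt0 *.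
set T := [set i | v 0 i != 0] in wt_gt0 dualE *.
have nzT i : i \in T -> v 0 i != 0 by rewrite inE.
(* Pairing with the all-one word excludes weight 1. *)
have: #|T| != 1%N.
  apply/negP => /cards1P[i defT]; have := dualE 0 1.
  rewrite defT big_set1 mul0r tr0 add0r mulr1 => /eqP; apply/negP/nzT.
  by rewrite defT set11.
move=> T1; suff: #|T| != 2%N by lia.
apply/negP => /cards2P[i [j [ij defT]]].
(* This [a] gives a line through [beta ^+ j] that avoids [beta ^+ i]; pairing with its word leaves
   only [v 0 i]. *)
have [a ta] := tr_nondeg (beta_inj ij).
have := dualE a (tr (a * beta ^+ j)).
rewrite defT big_setU1 ?inE //= big_set1 (addrr_pchar2 pchF) mulr0 addr0 -trD.
rewrite -mulrDr -(oppr_pchar2 pchL (beta ^+ j)) ta mulr1 => /eqP.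
apply/negP/nzT.
by rewrite defT set21.
Qed.

(* For m = 1 the powers of beta form an arc: no line contains three of them. *)
Lemma dual_wt_ge4 v : m = 1%N -> v \in dual_code C -> v != 0 -> (4 <= wt v)%N.
Proof.
move=> m1 Dv nz_v; have := dual_wt_ge3 Dv nz_v.
have dualE := dual_word_pairing _ _ Dv; rewrite /wt.
set T := [set i | v 0 i != 0] in dualE *.
suff: #|T| != 3%N by lia.
apply/negP=> /eqP cardT; have [i Ti] : exists i, i \in T.
  by apply/set0Pn; rewrite -card_gt0 cardT.
have /cards2P[j [k [jk defT']]] : #|T :\ i| == 2%N.
  by have := cardsD1 i T; rewrite Ti cardT; lia.
(* With this [a] the difference of the two points is scaled to 1, which has trace 0, so the line
   passes through both. *)
pose a := (beta ^+ j - beta ^+ k)^-1; pose b := tr (a * beta ^+ j).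
have nz_a : a != 0 by rewrite invr_eq0 beta_inj.
have Fj : j \in trace_fibre a b by rewrite inE.
have Fk : k \in trace_fibre a b.
  rewrite inE /b -subr_eq0 (oppr_pchar2 pchF) -trD -mulrDr addrC.
  rewrite -(oppr_pchar2 pchL (beta ^+ k)) mulVf ?beta_inj //.
  by rewrite -(scale1r (1 : L)) tr_in_alg.
have ijk : i \notin [set j; k] by rewrite -defT' !inE eqxx.
have le2 : (#|trace_fibre a b| <= 2)%N.
  have := card_trace_fibre b nz_a; rewrite m1.
  by case: ifP => _; rewrite !inE; [move/eqP-> | case/orP=> /eqP->].
have Fi : i \notin trace_fibre a b.
  apply/negP=> Fi; have : [set i; j; k] \subset trace_fibre a b.
    by apply/subsetP=> x /setUP[/set2P[]|/set1P] ->.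
  move/subset_leq_card/leq_trans/(_ le2).
  by rewrite -setUA cardsU1 ijk cards2 jk.
(* The third point is off the line, so the pairing reduces to a nonzero multiple of [v 0 i],
   contradicting [i \in T]. *)
have := dualE a b; rewrite (big_setD1 i) //= defT' big_setU1 ?inE //= big_set1.
move: Fj Fk Fi; rewrite !inE => /eqP-> /eqP->.
rewrite (addrr_pchar2 pchF) !mulr0 !addr0 => Fi /eqP.
rewrite mulf_eq0 addr_eq0 (oppr_pchar2 pchF) (negbTE Fi) orbF.
by apply/negP; move: Ti; rewrite inE.
Qed.

(** By linearity of the trace, pairing [v] with a word gives [tr] of [a] times the second sum, plus
    [b] times the first. *)
Lemma mem_dual_aug (v : 'rV[F]_n) :
  \sum_i v 0 i = 0 -> \sum_i v 0 i *: beta ^+ i = 0 ->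
  v \in dual_code C.
Proof.
move=> v0 vb; apply/dual_codeP=> _ /aug_codeP[a [b ->]].
rewrite (eq_bigr (fun i => v 0 i * tr (a * beta ^+ i) + v 0 i * b)); last first.
  by move=> i _; rewrite aug_wordE mulrDr.
rewrite big_split -mulr_suml /= v0 mul0r addr0.
transitivity (tr (a * (\sum_i v 0 i *: beta ^+ i))); last first.
  by rewrite vb mulr0 tr0.
rewrite mulr_sumr (big_morph _ trD tr0); apply: eq_bigr => i _.
by rewrite -scalerAr trZ.
Qed.

(* The powers of beta in GF(d) lie on a line through 0; for d > 2 there are
   at least three of them, which yields an affine dependency. *)
Lemma dual_word_wt3 : (1 < m)%N ->
  exists v : 'rV[F]_n, [/\ v \in dual_code C, v != 0 & (wt v <= 3)%N].
Proof.
move=> m_gt1; have [s sE] := norm_in_alg beta.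
have d_ge4 : (4 <= d)%N by rewrite -[4%N]/(2 ^ 2)%N leq_exp2l.
have lt2 : (q.+1 * 2 < n)%N by rewrite n_eq ltn_pmul2l // ; lia.
have lt1 : (q.+1 < n)%N by lia.
(* At the exponents 0, [q + 1] and [2 (q + 1)] the powers of [beta] are 1, [s] and [s ^+ 2], all in
   [F]. *)
pose i0 := Ordinal n_gt0; pose i1 := Ordinal lt1; pose i2 := Ordinal lt2.
have b1 : beta ^+ i1 = s%:A by [].
have b2 : beta ^+ i2 = (s ^+ 2)%:A.
  by rewrite /= exprM sE -[s%:A]/(in_alg L s) -rmorphXn.
have i10 : i1 != i0 by [].
have s1 : s + 1 != 0.
  have := beta_inj i10; apply: contraNneq => s0.
  rewrite b1 expr0 (oppr_pchar2 pchL) -(scale1r 1) scalerA mulr1 -scalerDl.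
  by rewrite s0 scale0r.
(* The coefficients are the cross product of (1, 1, 1) and (1, s, s^2), with signs dropped in
   characteristic 2; the last one is nonzero by [s1]. *)
pose v : 'rV[F]_n := (s + s ^+ 2) *: delta_mx 0 i0
  + (1 + s ^+ 2) *: delta_mx 0 i1 + (s + 1) *: delta_mx 0 i2.
have i20 : i2 != i0 by rewrite -val_eqE /=; lia.
have i21 : i2 != i1 by rewrite -val_eqE /=; lia.
have sumv (V : lmodType F) (x : 'I_n -> V) : \sum_i v 0 i *: x i =
    (s + s ^+ 2) *: x i0 + (1 + s ^+ 2) *: x i1 + (s + 1) *: x i2.
  rewrite (bigD1 i0) // (bigD1 i1) // (bigD1 i2) /= ?i20 // big1 ?addr0 ?addrA.
    rewrite !mxE !eqxx ![i0 == _]eq_sym (eq_sym i1 i2).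
    rewrite (negbTE i10) (negbTE i20) (negbTE i21).
    by rewrite !mulr1 !mulr0 !addr0 !add0r.
  move=> i /andP[/andP[n0 n1] n2]; rewrite !mxE !eqxx /=.
  by rewrite (negbTE n0) (negbTE n1) (negbTE n2) !mulr0 !addr0 scale0r.
have e2 : (2 : F) = 0 by rewrite (pcharf0 pchF).
exists v; split.
- apply: mem_dual_aug.
    rewrite (eq_bigr (fun i => v 0 i *: (1 : F^o))) => [|i _]; last first.
      by rewrite [RHS]mulr1.
    rewrite sumv ![_ *: _]mulr1.
    by transitivity (2 * (s + s ^+ 2 + 1)); [ring | rewrite e2 mul0r].
  rewrite sumv b1 b2 expr0 !scalerA -!scalerDl.
  transitivity ((2 * (s + s ^+ 2 + s ^+ 3))%:A : L); last first.
    by rewrite e2 mul0r scale0r.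
  by congr (_ *: _); ring.
- apply: contraNneq s1 => v0; move/rowP/(_ i2): v0.
  rewrite !mxE !eqxx (negbTE i20) (negbTE i21) !andbF !mulr0 !add0r mulr1.
  by move=> ->.
rewrite /wt; apply: (@leq_trans #|[set i0; i1; i2]|).
  apply/subset_leq_card/subsetP=> i; rewrite !inE; apply: contraNT.
  rewrite !negb_or => /andP[/andP[n0 n1] n2]; rewrite !mxE !eqxx /=.
  by rewrite (negbTE n0) (negbTE n1) (negbTE n2) !mulr0 !addr0.
by rewrite -setUA cardsU1 cards2; do !case: (_ \in _); case: (_ != _).
Qed.

End QuadraticTrace.

(* Pigeonhole: there are q^4 vectors on four coordinates, but only q^3 values
   in F * L of the pair of sums that have to vanish on the dual. *)
Lemma dual_word_wt4 (F : finFieldType) (L : splittingFieldType F) (e n : nat)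
    (beta : L) :
  #|F| = (2 ^ e)%N -> \dim {:L} = 2%N -> #|finvect_type L| = (#|F| ^ 2)%N ->
  (4 <= n)%N ->
  exists v : 'rV[F]_n, [/\ v \in dual_code (aug_code n beta), v != 0
    & (wt v <= 4)%N].
Proof.
move=> cardF dimL cardL /subnKC; move: (n - 4)%N => k <-.
pose ext (u : 'rV[F]_4) : 'rV[F]_(4 + k) := row_mx u 0.
pose f (u : 'rV[F]_4) : F * finvect_type L :=
  (\sum_i ext u 0 i, \sum_i ext u 0 i *: (beta ^+ i : finvect_type L)).
have /injectivePn[u [u' uu' /eqP]] : ~~ injectiveb f.
  apply/negP=> /injectiveP/leq_card; rewrite card_mx card_prod cardL.
  by rewrite mul1n -expnS leq_exp2l // finNzRing_gt1.
rewrite xpair_eqE -subr_eq0 -[X in _ && X]subr_eq0 -!sumrB.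
case/andP=> /eqP s1 /eqP s2.
have extB i : ext (u - u') 0 i = ext u 0 i - ext u' 0 i.
  by rewrite /ext -[X in row_mx _ X](subr0 0) -add_row_mx -opp_row_mx !mxE.
exists (ext (u - u')); split.
- apply: (mem_dual_aug cardF dimL).
    by rewrite -[RHS]s1; apply: eq_bigr => i _; rewrite extB.
  by rewrite -[RHS]s2; apply: eq_bigr => i _; rewrite extB scalerBl.
- apply: contra_neq uu' => /(congr1 lsubmx); rewrite row_mxKl linear0.
  exact: subr0_eq.
apply: (@leq_trans #|[set lshift k j | j : 'I_4]|); last first.
  by rewrite (leq_trans (leq_imset_card _ _)) // card_ord.
apply/subset_leq_card/subsetP=> i; rewrite inE.
have [j ->|j ->] := split_ordP i; first by rewrite imset_f.
by rewrite row_mxEr mxE eqxx.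
Qed.

(** * Order of [beta] and the parameters of the code and its dual *)

(** The order of [alpha] divides the number of nonzero elements of [L], and is no smaller because
    its powers reach all of them. *)
Lemma mult_generator_prim (F : finFieldType) (L : splittingFieldType F)
    (alpha : L) : mult_generator alpha ->
  #|finvect_type L|.-1.-primitive_root alpha.
Proof.
case=> nz_alpha gen; pose r := #|finvect_type L|.
have r_gt1 : (1 < r)%N := finNzRing_gt1 (finvect_type L).
have alpha1 : alpha ^+ r.-1 = 1.
  apply: (mulfI nz_alpha); rewrite -exprS prednK ?mulr1 1?ltnW //.
  exact: (expf_card (alpha : finvect_type L)).
have r1_gt0 : (0 < r.-1)%N by rewrite -ltnS prednK // ltnW.
have [M prim_M M_dvd] := prim_order_exists r1_gt0 alpha1.
suff <- : M = r.-1 by [].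
apply/eqP; rewrite eqn_leq dvdn_leq //=.
have -> : r.-1 = #|[set~ (0 : finvect_type L)]| by rewrite cardsC1.
pose f (i : 'I_M) : finvect_type L := alpha ^+ i.
apply: (@leq_trans #|f @: setT|); last first.
  by rewrite (leq_trans (leq_imset_card _ _)) // cardsT card_ord.
apply/subset_leq_card/subsetP=> x; rewrite !inE => /gen[i ->].
apply/imsetP; exists (Ordinal (ltn_pmod i (prim_order_gt0 prim_M))) => //.
by rewrite /f /= (prim_expr_mod prim_M).
Qed.

Theorem theorem5 (m k q d n N r : nat)
    (hm : (1 <= m)%N) (hk : (1 <= k)%N)
    (hq : q = (2 ^ (k * m))%N) (hd : d = (2 ^ m)%N)
    (hn : n = ((q + 1) * (d - 1))%N) (hN : N = ((q - 1) %/ (d - 1))%N)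
    (hr : r = (q ^ 2)%N)
    (F : finFieldType) (hF : #|F| = q)
    (L : splittingFieldType F) (hL : #|finvect_type L| = r)
    (alpha : L) (halpha : mult_generator alpha)
    (beta : L) (hbeta : beta = alpha ^+ N) :
  let C : {set 'rV[F]_n} := aug_code n beta in
  [/\ cyclic_code C,
      code_dim C = 3%N,
      (forall w : nat, (w != 0%N /\ exists2 c, c \in C & wt c = w) <->
         w \in [:: (n - d)%N; (n - d + 1)%N; n])
    & min_dist (dual_code C) = (if m == 1 then 4 else 3)%N].
Proof.

move=> C.
have cardF : #|F| = (2 ^ (k * m))%N by rewrite hF.
have dimL : \dim {:L} = 2%N.
  have := card_vspace {:finvect_type L}; rewrite card_vspacef hL hr -hF.
  by move/eqP; rewrite (eqn_exp2l _ _ (finNzRing_gt1 F)) => /eqP.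
have cardL : #|finvect_type L| = (#|F| ^ 2)%N by rewrite hL hF.
have n_eq : n = (#|F|.+1 * (2 ^ m).-1)%N by rewrite hn hd hF addn1 subn1.
have n_ge3 : (3 <= n)%N.
  rewrite n_eq -[3%N]muln1 leq_mul // ?ltnS ?finNzRing_gt1 //.
  by rewrite -ltnS prednK ?expn_gt0 // -[1%N]/(2 ^ 0)%N ltn_exp2l.
have beta_prim : n.-primitive_root beta.
  have d1q : (d - 1 %| q - 1)%N.
    by rewrite hq hd !subn1 mulnC expnM dvdn_pred_predX.
  (* From [r - 1 = (q - 1)(q + 1)] and the exactness of the division defining [N]; hence
     [alpha ^+ N] has order [n]. *)
  have rE : (r.-1 = N * n)%N.
    have := divnK d1q; rewrite -hN hn hr => Nd.
    by rewrite mulnCA Nd -subn1; apply: etrans (subn_sqr q 1) (mulnC _ _).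
  have := mult_generator_prim halpha; rewrite hL rE => alpha_prim.
  have := dvdn_prim_root alpha_prim (dvdn_mull N (dvdnn n)).
  by rewrite mulnK -?hbeta // ltnW // ltnW.
have submC := aug_code_submod cardF dimL n beta.
have submD := dual_code_submod C.
split.
- exact: (aug_code_cyclic cardF dimL beta_prim).
- apply: code_dim_card => //.
  exact: (card_aug_code cardF dimL hm n_eq beta_prim cardL).
- by rewrite hd; apply: (aug_code_weights cardF dimL hm n_eq beta_prim).
have [m1|m_neq1] := eqVneq m 1%N.
  have geC : (4 <= min_dist (dual_code C))%N.
    apply: min_dist_ge => // v.
    exact: (dual_wt_ge4 cardF dimL hm n_eq beta_prim m1).
  apply/eqP; rewrite eqn_leq geC andbT.
  (* For [n = 3], which is the case [q = 2], the dual is the zero code, and the default value [n.+1]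
     of [min_dist] is the required 4. *)
  have [n4|n3] := leqP 4 n; last by apply: leq_trans (min_dist_len _) _.
  have [v [Dv nz_v wt_v]] := dual_word_wt4 beta cardF dimL cardL n4.
  by apply: leq_trans wt_v; apply: min_dist_le.
have m_gt1 : (1 < m)%N by lia.
apply/eqP; rewrite eqn_leq; apply/andP; split.
  have [v [Dv nz_v wt_v]] := dual_word_wt3 cardF dimL hm n_eq beta_prim m_gt1.
  by apply: leq_trans wt_v; apply: min_dist_le.
apply: min_dist_ge => //; first by lia.
move=> v; exact: (dual_wt_ge3 cardF dimL hm n_eq beta_prim).
Qed.
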